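(* For a set $X\subseteq\mathbb{R}$ the following are equivalent: (1) $X$ is an $A_1$-set; (2) for every Borel function $\Psi: X\to {}^{\mathbb N}\mathbb N$, the image $\Psi[X]$ has Rothberger's property $C''$; (3) $X$ is an $R^{\mathcal M}$-set.
   Context: $A_1$-set: $X\subseteq\mathbb R$ is an $A_1$-set if for every sequence $(\mathfrak U_1,\mathfrak U_2,\dots)$ where each $\mathfrak U_n$ is a countable collection of Borel subsets of $\mathbb R$ with $X\subseteq\bigcup\mathfrak U_n$, there is a sequence $(Y_1,Y_2,\dots)$ with $Y_n\in\mathfrak U_n$ for each $n$ and $X\subseteq\bigcup_{n}Y_n$. A function $\Psi:X\to{}^{\mathbb N}\mathbb N$ (Baire space with the product topology) is Borel if the preimage of every open set is a Borel subset of $X$, i.e. of the form $X\cap B$ with $B\subseteq\mathbb R$ Borel. A set $Y$ has Rothberger's property $C''$ if for every sequence $(\mathcal G_n)_{n}$ of open covers of $Y$ there are $G_n\in\mathcal G_n$ with $Y\subseteq\bigcup_n G_n$. $\mathcal M$ denotes the ideal of first category (meager) subsets of $\mathbb R$. A Borel set $H\subseteq\mathbb R\times\mathbb R$ is an $\mathcal M$-set if $(H)_x=\{y:(x,y)\in H\}\in\mathcal M$ for every $x\in\mathbb R$. $X$ is an $R^{\mathcal M}$-set if for every $\mathcal M$-set $H$, $\bigcup_{x\in X}(H)_x\neq\mathbb R$. *)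

(* Defs.v *)
From mathcomp Require Import all_boot all_order all_algebra.
From mathcomp Require Import all_classical all_reals all_analysis.
Import numFieldNormedType.Exports.

Set Implicit Arguments.
Unset Strict Implicit.
Unset Printing Implicit Defensive.

Local Open Scope classical_set_scope.

(* [nat] carries the discrete topology. *)
Definition baire_space : topologicalType := {ptws nat -> nat}.

Definition borel (T : topologicalType) : set (set T) := <<s @open T >>.

Definition nowhere_dense (T : topologicalType) (A : set T) : Prop :=
  interior (closure A) = set0.

Definition meager (T : topologicalType) (A : set T) : Prop :=
  exists2 F : nat -> set T,
    (forall n, nowhere_dense (F n)) & A `<=` \bigcup_n F n.

(* Here and in [rothberger], the covering families are required to be nonempty.
   This is automatic unless the covered set is empty; without it the empty set
   would fail both properties, as no member can be chosen from an empty family. *)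
Definition A1_set (R : realType) (X : set R) : Prop :=
  forall U : nat -> set (set R),
    (forall n, [/\ U n !=set0, countable (U n), U n `<=` @borel R &
                   X `<=` \bigcup_(B in U n) B]) ->
    exists2 Y : nat -> set R, (forall n, U n (Y n)) & X `<=` \bigcup_n Y n.

(* Covers of [Y] consist of open sets of the ambient space. *)
Definition rothberger (T : topologicalType) (Y : set T) : Prop :=
  forall G : nat -> set (set T),
    (forall n, [/\ G n !=set0, G n `<=` @open T &
                   Y `<=` \bigcup_(V in G n) V]) ->
    exists2 V : nat -> set T, (forall n, G n (V n)) & Y `<=` \bigcup_n V n.

(* A function defined on [X] is represented by a total function, of which only
   the values on [X] matter. The library's [measurable_fun X f] would hold
   vacuously for a non-Borel [X]. *)
Definition borel_fun_on (S T : topologicalType) (X : set S) (f : S -> T) : Prop :=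
  forall V : set T, open V ->
    exists2 B : set S, borel B & X `&` f @^-1` V = X `&` B.

Definition M_set (R : realType) (H : set (R * R)) : Prop :=
  borel H /\ forall x : R, meager (xsection H x).

Definition RM_set (R : realType) (X : set R) : Prop :=
  forall H : set (R * R), M_set H -> \bigcup_(x in X) xsection H x <> setT.

(* Main.v *)
(* (1) and (2) both amount to the selection principle for sequences of countable
   Borel covers of X: for (2), send x to the sequence of least indices of the
   sets containing it.
   (3) -> (1): in the n-th basic interval fix disjoint open intervals V(n,k), and
   let H_x be the set of y such that y in V(n,k) never meets x in U(n,k). Each
   H_x is nowhere dense, and a point y outside the union selects for each n at
   most one k, namely the one with y in V(n,k).
   (1) -> (3): Borel sets have the Baire property uniformly in their sections, so
   an M-set is covered by countably many sets whose sections are closed and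
   nowhere dense. A point y missing all of them over X is found by descending
   through basic intervals, each step being a guess made for all x in X at once.
   The selection principle first bounds the intervals to be considered at each
   step, which makes a strategy on them a finite object, and then guesses that
   strategy. *)

Require Import Defs.
From mathcomp Require Import all_boot all_order all_algebra.
From mathcomp Require Import all_classical all_reals all_analysis.
From mathcomp Require Import zify lra.
Import numFieldNormedType.Exports.
Local Open Scope classical_set_scope.

Set Implicit Arguments.
Unset Strict Implicit.
Unset Printing Implicit Defensive.

(** * Borel sets and selection from Borel covers *)

Lemma borelC (T : topologicalType) (A : set T) :
  borel A -> borel [set x | ~ A x].
Proof.
have [_ Gc _] := smallest_sigma_algebra [set: T] (@open T).
by move=> /Gc; rewrite setTD.
Qed.

(** Set-builder form with quantifiers over a countable type lets the sets below be proved Borel by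
    following their defining formulas. *)
Lemma borel_ex (T : topologicalType) (I : countType) (F : I -> set T) :
  (forall i, borel (F i)) -> borel [set x | exists i, F i x].
Proof.
have [G0 _ Gu] := smallest_sigma_algebra [set: T] (@open T).
move=> bF; pose F' n := if unpickle n is Some i then F i else set0.
suff -> : [set x | exists i, F i x] = \bigcup_n F' n.
  by apply: Gu => n; rewrite /F'; case: unpickle => [i|//]; exact: bF.
apply/seteqP; split => x /=.
  by move=> [i Fix]; exists (pickle i) => //; rewrite /F' pickleK.
by move=> [n _]; rewrite /F'; case: unpickle => // i; exists i.
Qed.

Lemma borel_all (T : topologicalType) (I : countType) (F : I -> set T) :
  (forall i, borel (F i)) -> borel [set x | forall i, F i x].
Proof.
move=> bF; suff -> : [set x | forall i, F i x] =
    [set x | ~ exists i, ~ F i x].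
  by apply: borelC; apply: borel_ex => i; apply: borelC; exact: bF.
apply/seteqP; split => x /= Fx; first by case=> i; apply; exact: Fx.
by move=> i; apply: contrapT => nF; apply: Fx; exists i.
Qed.

Lemma borelI (T : topologicalType) (A B : set T) :
  borel A -> borel B -> borel [set x | A x /\ B x].
Proof.
move=> bA bB; suff -> : [set x | A x /\ B x] =
    [set x | forall b : bool, (if b then A else B) x].
  by apply: borel_all; case.
apply/seteqP; split => x /=; first by move=> [? ?] [].
by move=> H; split; [exact: (H true)|exact: (H false)].
Qed.

Lemma borel_const (T : topologicalType) (P : Prop) : borel [set _ : T | P].
Proof.
have [G0 Gc _] := smallest_sigma_algebra [set: T] (@open T).
have [p|np] := pselect P.
  have -> : [set _ : T | P] = setT `\` set0 by apply/seteqP; split=> // ? _; split.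
  exact: Gc.
by have -> : [set _ : T | P] = set0 by rewrite -subset0 => x /np.
Qed.

Lemma borel_imply (T : topologicalType) (P : Prop) (A : set T) :
  (P -> borel A) -> borel [set x | P -> A x].
Proof.
move=> bA; have [p|np] := pselect P.
  have -> : [set x | P -> A x] = A by apply/seteqP; split=> x //=; apply.
  exact: bA.
have -> : [set x | P -> A x] = [set _ | True].
  by apply/seteqP; split=> x //= _ /np.
exact: borel_const.
Qed.

Lemma borel_open (T : topologicalType) (A : set T) : open A -> borel A.
Proof. by move=> oA; apply: sub_gen_smallest. Qed.

Lemma borelT (T : topologicalType) : borel [set: T].
Proof. exact: borel_open openT. Qed.

Lemma borel_preimage (S T : topologicalType) (f : S -> T) (A : set T) :
  continuous f -> borel A -> borel (f @^-1` A).
Proof.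
have [G0 Gc Gu] := smallest_sigma_algebra [set: S] (@open S).
move=> /continuousP cf; apply: (smallest_sub (X := [set A | borel (f @^-1` A)])).
  split => [|B|F] /=; first by rewrite preimage_set0.
    exact: Gc.
  by move=> bF; rewrite preimage_bigcup; exact: Gu.
by move=> B oB /=; apply: borel_open; exact: cf.
Qed.

(** Common middle term of the three properties: covers are enumerated by [nat], so a selection is
    just a function [nat -> nat]. *)
Definition selective (T : topologicalType) (X : set T) : Prop :=
  forall U : nat -> nat -> set T,
    (forall n k, borel (U n k)) ->
    (forall n x, X x -> exists k, U n k x) ->
    exists g : nat -> nat, forall x, X x -> exists n, U n (g n) x.

Lemma A1_selective (R : realType) (X : set R) : A1_set X -> selective X.
Proof.
move=> A1 U bU cU.
have [n|Y UY XY] := A1 (fun n => range (U n)).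
  split; [by exists (U n 0); exists 0| |by move=> _ [k _ <-]|].
    by apply: (sub_countable (card_image_le _ _)).
  by move=> x /(cU n)[k Ukx]; exists (U n k) => //; exists k.
have UY' : forall n, exists k, U n k = Y n.
  by move=> n; have [k _ <-] := UY n; exists k.
have [g gP] := choice UY'.
by exists g => x /XY[n _]; rewrite -gP => Ux; exists n.
Qed.

Lemma selective_A1 (R : realType) (X : set R) : selective X -> A1_set X.
Proof.
move=> sX U UP.
have enumU n : exists f : nat -> set R, range f = U n.
  have [U0 /pfcard_geP cU _ _] := UP n.
  case: cU => [e|[f]]; first by move: U0; rewrite e => -[? []].
  exists f; apply/seteqP; split=> [_ [k _ <-]|B UB]; first exact: funS.
  by have [k _ <-] := @surj _ _ _ _ f B UB; exists k.
have [B BP] := choice enumU.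
have [n k|n x Xx|g gP] := sX B.
- by have [_ _ + _] := UP n; apply; rewrite -BP; exists k.
- by have [_ _ _ /(_ _ Xx)[V]] := UP n; rewrite -BP => -[k _ <-]; exists k.
- exists (fun n => B n (g n)) => [n|x /gP[n]]; last by exists n.
  by rewrite -BP; exists (g n).
Qed.

(** * Strengthenings of the selection principle *)

(** Stages are split into columns [c i n], that is 2^i (2n+1). A separate selection in column [i]
    catches [x] at a stage at least 2^i, for every [i]. *)
Lemma selective_often (T : topologicalType) (X : set T)
    (U : nat -> nat -> set T) :
    selective X -> (forall n k, borel (U n k)) ->
    (forall n x, X x -> exists k, U n k x) ->
  exists g : nat -> nat,
    forall x, X x -> forall N, exists2 n, N <= n & U n (g n) x.
Proof.
move=> sX bU cU; pose c i n := 2 ^ i * n.*2.+1.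
have [h hP] := choice (fun i => sX (fun n => U (c i n))
  (fun n k => bU (c i n) k) (fun n x => cU (c i n) x)).
(* The 2-adic valuation of [m] recovers the column, and halving the odd part recovers the place in
   it. *)
exists (fun m => h (logn 2 m) (m %/ 2 ^ logn 2 m)./2) => x Xx N.
have [n Un] := hP N x Xx; exists (c N n).
  by rewrite (leq_trans (ltnW (ltn_expl N (ltnSn 1))))// leq_pmulr.
have e : logn 2 (c N n) = N.
  rewrite lognM ?expn_gt0// pfactorK// lognE/= dvdn2/= odd_double/= addn0 //.
by rewrite e mulKn ?expn_gt0//= uphalf_double.
Qed.

(* With [f_x m] the least [M] such that [P m M x], pick [g] with
   [f_x (f_x m) <= g m] infinitely often and let [a] be the orbit of 0 under an
   increasing majorant of [g]: if [a n <= m < a n.+1] then [f_x] maps one of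
   [a n], [a n.+1] to at most the next term. *)
Lemma selective_interleave (T : topologicalType) (X : set T)
    (P : nat -> nat -> set T) :
    selective X -> (forall m M, borel (P m M)) ->
    (forall x m m' M M', m' <= m -> M <= M' -> P m M x -> P m' M' x) ->
    (forall x m, X x -> exists M, P m M x) ->
  exists a : nat -> nat, (forall n, a n < a n.+1) /\
    forall x, X x -> forall N, exists2 n, N <= n & P (a n) (a n.+1) x.
Proof.
move=> sX bP mP cP.
pose Q m M := [set x | exists M', P m M' x /\ P M' M x].
have bQ m M : borel (Q m M) by apply: borel_ex => M'; exact: borelI.
have cQ m x : X x -> exists M, Q m M x.
  move=> Xx; have [M' PM'] := cP x m Xx; have [M PM] := cP x M' Xx.
  by exists M, M'.
have [g gP] := selective_often sX bQ cQ.
(* The sum makes [G] a monotone majorant of [g]; the term [m.+1] makes its orbit strictly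
   increasing. *)
pose G m := m.+1 + \sum_(i < m.+1) g i.
have leG m : g m <= G m by rewrite /G big_ord_recr/=; lia.
have homoG : {homo G : m n / m <= n}.
  move=> m n mn; rewrite /G leq_add//.
  by rewrite (big_ord_widen n.+1) // [leqRHS](bigID (fun i : 'I__ => i < m.+1))/= leq_addr.
pose a n := iter n G 0.
have aS n : a n < a n.+1 by rewrite /= /G; lia.
have leq_a : {homo a : m n / m <= n}.
  by apply: homo_leq => // [? ? ?|n]; [exact: leq_trans|exact: ltnW].
exists a; split=> // x Xx N; have [m Nm [M' [PmM' PM']]] := gP x Xx (a N).
have [n /andP[anm man]] : exists n, a n <= m < a n.+1.
  elim: (m) => [|k [n /andP[ank kan]]]; first by exists 0; apply/andP; split=> //; exact: aS.
  have [lt|ge] := ltnP k.+1 (a n.+1); first by exists n; rewrite lt leqW.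
  by exists n.+1; rewrite ge (leq_ltn_trans kan).
have Nn : N <= n.
  rewrite leqNgt; apply/negP => /leq_a; rewrite leqNgt => /negP; apply.
  exact: leq_ltn_trans Nm man.
(* If [M'] overshoots [a n.+1], then [P M' (g m)] yields the next instance, since
   [g m <= G m <= G (a n.+1)]. *)
have [M'a|aM'] := leqP M' (a n.+1); first by exists n => //; exact: mP PmM'.
exists n.+1; first exact: leqW.
apply: mP PM'; first exact: ltnW.
by rewrite (leq_trans (leG m))// homoG// ltnW.
Qed.

(* A guess at stage [n] proposes values at [n.+1] places, so that one of them is
   not claimed by the earlier stages. *)
Lemma selective_guess (T : topologicalType) (X : set T)
    (C : nat -> nat -> set T) :
    selective X -> (forall z t, borel (C z t)) ->
    (forall x, X x -> forall N, exists2 z, N <= z & exists t, C z t x) ->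
  exists tau : nat -> nat,
    forall x, X x -> forall N, exists2 z, N <= z & C z (tau z) x.
Proof.
move=> sX bC cC.
pose good n (l : seq (nat * nat)) :=
  [&& uniq (unzip1 l), size l == n.+1 & all (fun p => n <= p.1) l].
pose dec k : seq (nat * nat) := odflt [::] (unpickle k).
pose U n k := [set x | good n (dec k) /\
  forall p : nat * nat, p \in dec k -> C p.1 p.2 x].
have bU n k : borel (U n k).
  apply: borelI; first exact: borel_const.
  by apply: borel_all => p; apply: borel_imply => _.
have cU n x : X x -> exists k, U n k x.
  move=> Xx.
  suff [l lP lC] : exists2 l, good n l & forall p : nat * nat, p \in l -> C p.1 p.2 x.
    have e : dec (pickle l) = l by rewrite /dec pickleK.
    by exists (pickle l); split; rewrite e.
  rewrite /good; elim: (n.+1) => [|m [l /and3P[ul /eqP sl al] lC]].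
    by exists [::].
  have [z + [t Czt]] := cC x Xx (n + (\max_(p <- l) p.1).+1).
  move=> zP; exists ((z, t) :: l).
    rewrite /= ul sl eqxx al andbT /=; apply/andP; split; last lia.
    apply/mapP => -[p pl zp]; have : p.1 <= \max_(p <- l) p.1 by apply: (leq_bigmax_seq p).
    by move: zP; rewrite zp /=; lia.
  by move=> p; rewrite inE => /orP[/eqP ->//|]; exact: lC.
have [g gP] := selective_often sX bU cU.
pose l n := dec (g n).
(* [s n] lists the places claimed before stage [n]; a good stage claims its first proposed place
   outside that list. *)
pose pick n (s : seq nat) := head 0 [seq z <- unzip1 (l n) | z \notin s].
pose s n : seq nat := iteri n (fun i s => rcons s (pick i s)) [::].
have size_s n : size (s n) = n by elim: n => //= n; rewrite size_rcons => ->.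
pose zz n := pick n (s n).
have s_zz i n : i < n -> zz i \in s n.
  elim: n => // n IH; rewrite ltnS leq_eqVlt /= mem_rcons inE.
  by move=> /predU1P[->|/IH ->]; rewrite ?eqxx ?orbT.
(* Pigeonhole: [n.+1] distinct places cannot all be among the [n] claimed ones. *)
have zzP n : good n (l n) -> (zz n \in unzip1 (l n)) && (zz n \notin s n).
  move=> /and3P[ul /eqP sl _].
  rewrite andbC -(mem_filter (fun z => z \notin s n)) /zz /pick.
  case E: [seq _ <- _ | _] => [|z r]; last by rewrite mem_head.
  have : {subset unzip1 (l n) <= s n}.
    move=> z zl; apply: contraT => zs; have : z \in [::] by rewrite -E mem_filter zs.
    by [].
  by move=> /(uniq_leq_size ul); rewrite size_map sl size_s ltnn.
have zz_inj m n : good m (l m) -> good n (l n) -> zz m = zz n -> m = n.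
  move=> /zzP/andP[_ zm] /zzP/andP[_ zn] e.
  have [/s_zz|/s_zz|//] := ltngtP m n.
    by rewrite e (negbTE zn).
  by rewrite -e (negbTE zm).
(* Distinct good stages claim distinct places, so at most one of them prescribes the value at
   [z]. *)
have tauP z : exists t, forall n, good n (l n) -> zz n = z -> (z, t) \in l n.
  have [[n [gn <-]]|nz] := pselect (exists n, good n (l n) /\ zz n = z).
    have /andP[/mapP[[z' t] ztl /= zE] _] := zzP n gn.
    by exists t => m gm /(zz_inj _ _ gm gn) ->; rewrite zE.
  by exists 0 => n gn zn; case: nz; exists n.
have [tau {}tauP] := choice tauP.
exists tau => x Xx N; have [n Nn [gn Cn]] := gP x Xx N.
have tn := tauP _ n gn erefl.
exists (zz n); last exact: (Cn _ tn).
have /and3P[_ _ /allP/(_ _ tn)] := gn.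
exact: leq_trans.
Qed.

(* At time [n] the states [j <= a n] are finitely many, so a whole table of
   answers to them is a single guess. *)
Lemma selective_game (T : topologicalType) (X : set T)
    (B : nat -> nat -> nat -> set T) :
    selective X -> (forall n j k, borel (B n j k)) ->
    (forall n j x, X x -> exists k, B n j k x) ->
  exists b : nat -> nat,
    (forall n, b n.+1 = b n \/ exists2 x, X x & B n (b n) (b n.+1) x) /\
    (forall x, X x -> forall N, exists2 n, N <= n & B n (b n) (b n.+1) x).
Proof.
move=> sX bB cB.
pose P m M := [set x | forall p : nat * nat, p.1 <= m /\ p.2 <= m ->
  exists k, k <= M /\ B p.1 p.2 k x].
have [m M|x m m' M M' m'm MM' Px [n j] /= [nm jm]|x m Xx|a [aS aP]] :=
    @selective_interleave _ X P sX.
- apply: borel_all => p; apply: borel_imply => _; apply: borel_ex => k.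
  by apply: borelI => //; exact: borel_const.
- have [|k [kM ?]] := Px (n, j); first by split; exact: leq_trans m'm.
  by exists k; rewrite (leq_trans kM).
- have /choice[f fP] : forall p : nat * nat, exists k, B p.1 p.2 k x.
    by move=> p; exact: cB.
  exists (\max_(i < m.+1) \max_(j < m.+1) f (val i, val j)) => -[i j] /= [im jm].
  exists (f (i, j)); split; last exact: (fP (i, j)).
  pose i' : 'I_m.+1 := Ordinal (im : i < m.+1).
  pose j' : 'I_m.+1 := Ordinal (jm : j < m.+1).
  apply: leq_trans (leq_bigmax i').
  exact: (@leq_bigmax _ (fun j : 'I_m.+1 => f (i, val j)) j').
have leq_a : {homo a : m n / m <= n}.
  by apply: homo_leq => // [? ? ?|n]; [exact: leq_trans|exact: ltnW].
have le_a n : n <= a n by elim: n => // n /leq_ltn_trans; apply.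
pose tab t j : nat := nth 0 (odflt [::] (unpickle t : option (seq nat))) j.
pose C z t := [set x | forall j, j <= a z ->
  tab t j <= a z.+1 /\ B z j (tab t j) x].
have [z t|x Xx N|tau tauP] := @selective_guess _ X C sX.
- apply: borel_all => j; apply: borel_imply => _.
  by apply: borelI => //; exact: borel_const.
- have [z Nz Pz] := aP x Xx N; exists z => //.
  have /choice[f fP] : forall j, exists k,
      j <= a z -> k <= a z.+1 /\ B z j k x.
    move=> j; have [ja|aj] := leqP j (a z); last by exists 0.
    by have [//|k ?] := Pz (z, j); exists k.
  exists (pickle (mkseq f (a z).+1)) => j ja.
  have -> : tab (pickle (mkseq f (a z).+1)) j = f j.
    by rewrite /tab pickleK [odflt _ _]/= nth_mkseq.
  exact: fP.
(* A guess that is out of bounds or legal for no point of [X] is ignored: the state stays within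
   [a n], and every change is a legal move. *)
pose step n j := let k := tab (tau n) j in
  if (k <= a n.+1) && `[< exists2 x, X x & B n j k x >] then k else j.
pose b n := iteri n step 0.
have bS n : b n.+1 = step n (b n) by [].
have ba n : b n <= a n.
  elim: n => // n IH; rewrite bS /step; case: ifP => [/andP[]//|_].
  by rewrite (leq_trans IH)// leq_a.
exists b; split=> [n|x Xx N].
  by rewrite bS /step; case: ifP => [/andP[_ /asboolP]|_]; [right|left].
have [z Nz /(_ _ (ba z))[ka Bz]] := tauP x Xx N; exists z => //.
rewrite bS /step ka /=; case: ifPn => // /asboolP[]; by exists x.
Qed.

(** * Images in the Baire space *)

Definition cylinder (s : seq nat) : set baire_space :=
  [set h | forall i, i < size s -> h i = nth 0 s i].

Lemma open_coordinate (i k : nat) : open [set h : baire_space | h i = k].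
Proof.
rewrite openE => h /= <-.
apply: (@proj_continuous nat (fun=> nat) i h [set h i]).
exact: discrete_set1.
Qed.

Lemma open_cylinder s : open (cylinder s).
Proof.
rewrite /cylinder; elim: (size s) => [|n IH].
  have -> : [set h : baire_space | forall i, i < 0 -> h i = nth 0 s i] = setT.
    by apply/seteqP; split.
  exact: openT.
have -> : [set h : baire_space | forall i, i < n.+1 -> h i = nth 0 s i] =
    [set h | forall i, i < n -> h i = nth 0 s i] `&`
    [set h | h n = nth 0 s n].
  apply/seteqP; split=> h /=.
    by move=> H; split=> [i /ltnW/H//|]; exact: H.
  move=> [hn hE] i; rewrite ltnS leq_eqVlt => /predU1P[->//|]; exact: hn.
by apply: openI => //; exact: open_coordinate.
Qed.

Lemma cylinder_mkseq (h : baire_space) n : cylinder (mkseq h n) h.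
Proof. by move=> i; rewrite size_mkseq => ilt; rewrite nth_mkseq. Qed.

(** The cylinders around [h] generate a filter converging to [h] in every coordinate, hence in the
    product topology. *)
Lemma open_cylinderP (V : set baire_space) (h : baire_space) :
  open V -> V h -> exists n, cylinder (mkseq h n) `<=` V.
Proof.
move=> oV Vh; pose F := filter_from [set: nat] (fun n => cylinder (mkseq h n)).
have FF : Filter F.
  apply: filter_from_filter; first by exists 0.
  move=> i j _ _; exists (maxn i j) => // f; rewrite /cylinder/= !size_mkseq.
  by move=> fh; split=> k kl;
    rewrite fh ?leq_max ?kl ?orbT// !nth_mkseq ?leq_max ?kl ?orbT.
have : {ptws, F --> h}.
  apply/pointwise_cvgP => t B /nbhs_singleton Bht.
  exists t.+1 => // f /(_ t); rewrite size_mkseq nth_mkseq// => ft.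
  by rewrite /= ft.
by case/(_ V (open_nbhs_nbhs (conj oV Vh))) => n _ ?; exists n.
Qed.

(** Cylinders form a countable base: each open cover is refined by the cylinders inside its members,
    whose preimages are Borel on [X]. *)
Lemma selective_rothberger (T : topologicalType) (X : set T)
    (Psi : T -> baire_space) :
  selective X -> borel_fun_on X Psi -> rothberger (Psi @` X).
Proof.
move=> sX bPsi G GP.
have preim s : exists B, borel B /\ X `&` Psi @^-1` cylinder s = X `&` B.
  by have [B] := bPsi _ (@open_cylinder s); exists B.
have [B BP] := choice preim.
pose dec k : seq nat := odflt [::] (unpickle k).
pose U n k := [set x | (exists2 V, G n V & cylinder (dec k) `<=` V) /\
  B (dec k) x].
have [n k|n x Xx|g gP] := sX U.
- by apply: borelI; [exact: borel_const|exact: (BP _).1].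
- have [_ oG /(_ (Psi x))[|V GV Vx]] := GP n; first by exists x.
  have [m mV] := open_cylinderP (oG _ GV) Vx.
  have e : dec (pickle (mkseq (Psi x) m)) = mkseq (Psi x) m.
    by rewrite /dec pickleK.
  exists (pickle (mkseq (Psi x) m)); rewrite /U /= e; split; first by exists V.
  have : (X `&` Psi @^-1` cylinder (mkseq (Psi x) m)) x.
    by split=> //; exact: cylinder_mkseq.
  by rewrite (BP _).2 => -[].
(* If no member contains the selected cylinder, any member will do: that stage catches no point. *)
- have pickV n : exists V, G n V /\
      ((exists2 V', G n V' & cylinder (dec (g n)) `<=` V') ->
       cylinder (dec (g n)) `<=` V).
    have [[V GV sV]|nV] := pselect (exists2 V', G n V' &
      cylinder (dec (g n)) `<=` V'); first by exists V.
    by have [[V GV] _ _] := GP n; exists V; split.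
  have [V VP] := choice pickV.
  exists V => [n|_ [x Xx <-]]; first exact: (VP n).1.
  have [n [exV Bx]] := gP x Xx; exists n => //; apply: (VP n).2 => //.
  have : (X `&` B (dec (g n))) x by [].
  by rewrite -(BP _).2 => -[].
Qed.

Lemma rothberger_selective (T : topologicalType) (X : set T) :
  (forall Psi : T -> baire_space,
     borel_fun_on X Psi -> rothberger (Psi @` X)) ->
  selective X.
Proof.
move=> rX U bU cU.
(* Passing to least indices makes the cover disjoint, so [Psi] is determined on [X]. *)
pose E n k := [set x | U n k x /\ forall j, j < k -> ~ U n j x].
have bE n k : borel (E n k).
  apply: borelI => //; apply: borel_all => j; apply: borel_imply => _.
  exact: borelC.
have exE n x : X x -> exists k, E n k x.
  move=> /(cU n)[k Ukx].
  have exU : exists k, `[< U n k x >] by exists k; exact/asboolP.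
  case: (ex_minnP exU) => m /asboolP Um minm; exists m; split=> // j jm Uj.
  by have := minm j (asboolT Uj); rewrite leqNgt jm.
have E_uniq n x j k : E n j x -> E n k x -> j = k.
  move=> [Uj ltj] [Uk ltk].
  by have [/ltk//|/ltj//|] := ltngtP j k.
pose Psi (x : T) : baire_space := fun n => xget 0 [set k | E n k x].
have PsiE x n : X x -> E n (Psi x n) x.
  by move=> /(exE n)[k Ek]; rewrite /Psi; case: xgetP => // /(_ k).
have [V oV||V UV XV] := rX Psi _ (fun n => range (fun k => [set h | h n = k])).
(* On [X] the preimage of [V] is the union, over the cylinders inside [V], of the sets of points
   whose least indices begin with [s]. *)
- exists [set x | exists s : seq nat, cylinder s `<=` V /\
      forall i, i < size s -> E i (nth 0 s i) x].
    apply: borel_ex => s; apply: borelI; first exact: borel_const.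
    by apply: borel_all => i; apply: borel_imply.
  apply/seteqP; split=> x [Xx].
    move=> /(open_cylinderP oV)[n nV]; split=> //.
    exists (mkseq (Psi x) n); split=> // i; rewrite size_mkseq => ilt.
    by rewrite nth_mkseq//; exact: PsiE.
  move=> [s [sV sE]]; split=> //; apply: sV => i /sE; apply: E_uniq.
  exact: PsiE.
- move=> n; split.
  + by exists [set h | h n = 0]; exists 0.
  + by move=> _ [k _ <-]; exact: open_coordinate.
  + by move=> h _; exists [set f | f n = h n] => //; exists (h n).
- have UV' n : exists k, [set h : baire_space | h n = k] = V n.
    by have [k _ ?] := UV n; exists k.
  have [g gP] := choice UV'.
  exists g => x Xx; have [|n _] := XV (Psi x); first by exists x.
  by rewrite -gP /= => e; exists n; rewrite -e; have [] := PsiE x n Xx.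
Qed.

(** * Borel sets with meager sections *)

Import Order.TTheory GRing.Theory Num.Theory.
Local Open Scope ring_scope.

Lemma nowhere_dense_dense (T : topologicalType) (F : set T) :
  nowhere_dense F -> dense (~` closure F).
Proof.
move=> F0 O [y Oy] oO; apply: contrapT => nO.
have : O `<=` interior (closure F).
  rewrite -open_subsetE// => z Oz; apply: contrapT => nFz.
  by apply: nO; exists z.
by rewrite (F0 : interior (closure F) = set0) => /(_ y Oy).
Qed.

Section basis.
Context {R : realType}.

(** Rational midpoint and index [n] of the radius 1/(n+1); a number that decodes to nothing codes
    the interval from -1 to 1. *)
Definition basis_code (k : nat) : rat * nat := odflt (0, 0%N) (unpickle k).
Definition lo (k : nat) : R :=
  ratr (basis_code k).1 - (basis_code k).2.+1%:R^-1.
Definition hi (k : nat) : R :=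
  ratr (basis_code k).1 + (basis_code k).2.+1%:R^-1.
Definition bitv (k : nat) : set R := [set y | lo k < y < hi k].

Lemma lo_lt_hi k : lo k < hi k.
Proof.
by rewrite /lo /hi ltrBlDr -addrA ltrDl addr_gt0.
Qed.

Lemma open_oo (a b : R) : open [set y | a < y < b].
Proof.
have -> : [set y | a < y < b] = `]a, b[%classic.
  by apply/seteqP; split=> y /=; rewrite in_itv.
exact: itv_open.
Qed.

(** The closed interval is kept inside [O] so that limits of nested intervals stay there; a radius
    below [e / 2] ensures this. *)
Lemma bitvP (O : set R) (y : R) : open O -> O y ->
  exists k, bitv k y /\ forall z, lo k <= z <= hi k -> O z.
Proof.
move=> oO Oy.
have [e /= e0 eO] : exists2 e : R, 0 < e & ball y e `<=` O.
  by apply/nbhs_ballP; exact: open_nbhs_nbhs.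
have [n] : exists n, 0 + n.+1%:R^-1 < e / 2 :> R.
  by apply: ltr_add_invr; rewrite divr_gt0.
rewrite add0r; set r : R := n.+1%:R^-1 => re.
have r0 : 0 < r by rewrite invr_gt0.
have [q] : exists q, ratr q \in `](y - r), (y + r)[.
  by apply: rat_in_itvoo; lra.
rewrite in_itv/= => /andP[q1 q2].
exists (pickle (q, n)); rewrite /bitv /lo /hi /basis_code pickleK /= -/r.
split; first by apply/andP; split; lra.
by move=> z /andP[z1 z2]; apply: eO; rewrite /ball/= ltr_norml; apply/andP; split; lra.
Qed.

Lemma open_bitv k : open (bitv k).
Proof. exact: open_oo. Qed.

Definition strip (A : nat -> set R) : set (R * R) :=
  [set p | exists k, A k p.1 /\ bitv k p.2].

(* Every vertical section of [H] agrees with the open set [strip A] off the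
   complements of the open dense sets [strip (N n)], all of these being built
   from Borel sets and basic intervals only. *)
Definition baire_rep (H : set (R * R)) : Prop :=
  exists (A : nat -> set R) (N : nat -> nat -> set R),
    [/\ forall k, borel (A k), forall n k, borel (N n k),
        forall n x j, exists2 y, bitv j y & strip (N n) (x, y) &
        forall p, (forall n, strip (N n) p) -> (H p <-> strip A p)].

Lemma bitv_nonempty k : exists y, bitv k y.
Proof.
by exists ((lo k + hi k) / 2); rewrite /bitv /=; have := lo_lt_hi k; lra.
Qed.

Lemma strip_setT x y : strip (fun _ => setT) (x, y).
Proof. by have [k [ky _]] := @bitvP setT y openT I; exists k. Qed.

Lemma baire_rep0 : baire_rep set0.
Proof.
exists (fun=> set0), (fun _ _ => setT); split=> [k|n k|n x j|p _].
- by apply: borel_open; exact: open0.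
- exact: borelT.
- by have [y jy] := bitv_nonempty j; exists y => //; exact: strip_setT.
- by split=> // -[? []].
Qed.

(** [strip A'] is, section by section, the exterior of [strip A]. An open set together with its
    exterior is dense; this union is the added [N' 0]. *)
Lemma baire_repC H : baire_rep H -> baire_rep (setT `\` H).
Proof.
move=> [A [N [bA bN dN HA]]].
pose A' k := [set x | forall l, bitv k `&` bitv l !=set0 -> ~ A l x].
have bA' k : borel (A' k).
  by apply: borel_all => l; apply: borel_imply => _; exact: borelC.
pose N' n := if n is m.+1 then N m else
  fun k => [set x | exists b : bool, (if b then A k else A' k) x].
exists A', N'; split=> [//|n k|n x j|[x y] Np].
- by case: n => [|n] /=; [apply: borel_ex => -[]|].
- case: n => [|n] /=; last exact: dN.
  have [[y [jy [k [Ak ky]]]]|nA] := pselect (exists y, bitv j y /\ strip A (x, y)).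
    by exists y => //; exists k; split=> //; exists true.
  have [y jy] := bitv_nonempty j; exists y => //; exists j; split=> //.
  exists false => l [z [jz lz]] Al; apply: nA.
  by exists z; split=> //; exists l.
- have NN n : strip (N n) (x, y) by exact: (Np n.+1).
  have AA' : strip A' (x, y) -> ~ strip A (x, y).
    by move=> [k [A'k ky]] [l [Al ly]]; apply: (A'k l) => //; exists y.
  split.
    move=> [_ nH]; have [k [[b Ab] ky]] := Np 0%N.
    case: b Ab => Ab; last by exists k.
    by case: nH; apply/(HA _ NN); exists k.
  by move=> sA'; split=> // /(HA _ NN); exact: AA'.
Qed.

Lemma baire_rep_bigcup (H : nat -> set (R * R)) :
  (forall i, baire_rep (H i)) -> baire_rep (\bigcup_i H i).
Proof.
move=> /choice[A] /choice[N] HP.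
pose dec m : nat * nat := odflt (0, 0)%N (unpickle m).
exists (fun k => [set x | exists i, A i k x]), (fun m => N (dec m).1 (dec m).2).
split=> [k|m k|m x j|p Np].
- by apply: borel_ex => i; have [bA _ _ _] := HP i.
- by have [_ bN _ _] := HP (dec m).1.
- by have [_ _ dN _] := HP (dec m).1; exact: dN.
- have Npi i n : strip (N i n) p.
    have e : dec (pickle (i, n)) = (i, n) by rewrite /dec pickleK.
    by have := Np (pickle (i, n)); rewrite e.
  split.
    move=> [i _ Hi]; have [_ _ _ /(_ p (Npi i))[/(_ Hi)[k [Ak kp]] _]] := HP i.
    by exists k; split=> //; exists i.
  move=> [k [[i Ak] kp]]; exists i => //.
  by have [_ _ _ /(_ p (Npi i))[_]] := HP i; apply; exists k.
Qed.

Lemma open_baire_rep H : open H -> baire_rep H.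
Proof.
move=> oH.
exists (fun k => [set x | exists l, (forall p, bitv l p.1 -> bitv k p.2 -> H p) /\
  bitv l x]), (fun _ _ => setT); split=> [k|n k|n x j|[x y] _].
- apply: borel_ex => l; apply: borelI; first exact: borel_const.
  by apply: borel_open; exact: open_bitv.
- exact: borelT.
- by have [y jy] := bitv_nonempty j; exists y => //; exact: strip_setT.
- split; last by move=> [k [[l [lkH lx]] ky]]; exact: lkH.
  move=> Hxy; have [[P Q] /= [Px Qy] PQH] : nbhs (x, y) H by exact: open_nbhs_nbhs.
  have [l [lx lP]] := bitvP (@open_interior _ P) Px.
  have [k [ky kQ]] := bitvP (@open_interior _ Q) Qy.
  exists k; split=> //; exists l; split=> // -[u v] /= /andP[u1 u2] /andP[v1 v2].
  by apply: PQH; split=> /=; apply: interior_subset; [apply: lP|apply: kQ];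
    rewrite !ltW.
Qed.

Lemma borel_baire_rep H : borel H -> baire_rep H.
Proof.
apply: (smallest_sub (X := baire_rep)); last exact: open_baire_rep.
split; [exact: baire_rep0|exact: baire_repC|exact: baire_rep_bigcup].
Qed.

(** A point of [H] in all strips would give an interval [bitv k] on which the section of [H]
    contains a countable intersection of open dense sets. By Baire's theorem that section would not
    be meager. *)
Lemma M_set_strip H : M_set H -> exists N : nat -> nat -> set R,
  [/\ forall n k, borel (N n k),
      forall n x j, exists2 y, bitv j y & strip (N n) (x, y) &
      forall p, (forall n, strip (N n) p) -> ~ H p].
Proof.
move=> [/borel_baire_rep[A [N [bA bN dN HA]]] mH]; exists N; split=> // -[x y] Np.
move/(HA _ Np) => [k [Ak ky]]; have [F F0 HF] := mH x.
have NG n : open [set z | strip (N n) (x, z)].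
  have -> : [set z | strip (N n) (x, z)] = \bigcup_(i in [set i | N n i x]) bitv i.
    by apply/seteqP; split=> z [i] /=; [move=> []|]; exists i.
  by apply: bigcup_open => i _; exact: open_bitv.
pose G n := [set z | strip (N n) (x, z)] `&` ~` closure (F n).
have dG : dense (\bigcap_n G n).
  apply: (@Baire R R) => n; split.
    by apply: openI => //; apply: closed_openC; exact: closed_closure.
  apply: denseI => //; last exact: nowhere_dense_dense.
  move=> O [z Oz] oO; have [j [jz jO]] := bitvP oO Oz.
  have [v jv Nv] := dN n x j; exists v; split=> //; apply: jO.
  by move/andP: jv => [? ?]; rewrite !ltW.
have [||z [kz Gz]] := dG (bitv k); first by exists y.
  exact: open_bitv.
have Hz : H (x, z) by apply/HA => [n|]; [exact: (Gz n I).1|exists k].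
have [|n _ Fz] := HF z; first by rewrite /xsection /= inE.
by have [_] := Gz n I; apply; exact: subset_closure.
Qed.

End basis.

(** * Selection and unions of meager sections *)

Lemma nested_point (R : realType) (l r : nat -> R) :
  (forall n, l n < r n) -> (forall n, l n <= l n.+1) ->
  (forall n, r n.+1 <= r n) -> exists y, forall n, l n <= y <= r n.
Proof.
move=> lr lS rS.
have lm : {homo l : m n / (m <= n)%N >-> m <= n}.
  by apply: homo_leq => //; exact: le_trans.
have rm : {homo r : m n / (m <= n)%N >-> n <= m}.
  by apply: homo_leq => // a b c ab bc; exact: le_trans bc ab.
have lub n m : l m <= r n.
  have [mn|/ltnW nm] := leqP m n.
    exact: le_trans (lm _ _ mn) (ltW (lr n)).
  exact: le_trans (ltW (lr m)) (rm _ _ nm).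
exists (sup (range l)) => n; apply/andP; split.
  apply: ub_le_sup; last by exists n.
  by exists (r 0%N) => _ [m _ <-].
apply: ge_sup; first by exists (l 0%N); exists 0%N.
by move=> _ [m _ <-].
Qed.

(** Game on basic intervals: a move legal for [x] at time [n] shrinks both ends strictly and enters
    the sections at [x] of the strips [N 0] to [N n]. The limit of the run lies in every strip over
    every [x] in [X]. *)
Lemma selective_RM (R : realType) (X : set R) : selective X -> RM_set X.
Proof.
move=> sX H /M_set_strip[N [bN dN HN]] cov.
pose B n j k := [set x | (lo j < lo k :> R /\ hi k < hi j :> R) /\
  forall i, (i <= n)%N -> exists l, (bitv k `<=` (bitv l : set R)) /\ N i l x].
have bB n j k : borel (B n j k).
  apply: borelI; first exact: borel_const.
  apply: borel_all => i; apply: borel_imply => _; apply: borel_ex => l.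
  by apply: borelI => //; exact: borel_const.
have subb k k' : (lo k' <= lo k :> R) -> (hi k <= hi k' :> R) ->
    bitv k `<=` (bitv k' : set R).
  by move=> kk kk' z /andP[z1 z2]; apply/andP; split; lra.
have cB n j x : X x -> exists k, B n j k x.
  move=> _; suff: exists k, (lo j < lo k :> R /\ hi k < hi j :> R) /\
      forall i, (i < n.+1)%N -> exists l, (bitv k `<=` (bitv l : set R)) /\ N i l x.
    by [].
  have step (O : set R) y : open O -> O y -> O `<=` bitv j -> exists k,
      (forall z, lo k <= z <= hi k -> O z) /\
      (lo j < lo k :> R /\ hi k < hi j :> R).
    move=> oO Oy Oj; have [k [_ kO]] := bitvP oO Oy; have lk := @lo_lt_hi R k.
    exists k; split=> //.
    have /andP[? _] : bitv j (lo k : R) by apply: Oj; apply: kO; rewrite lexx ltW.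
    have /andP[_ ?] : bitv j (hi k : R) by apply: Oj; apply: kO; rewrite lexx ltW.
    by [].
  (* The interval is shrunk into one open dense section at a time. *)
  elim: n.+1 => [|m [k [[jk kj] kP]]].
    have [y jy] := @bitv_nonempty R j.
    by have [//|k [_ kP]] := step _ _ (@open_bitv R j) jy; exists k.
  have [y ky [l [Nl ly]]] := dN m x k.
  have [||//|k' [k'P k'j]] := step (bitv k `&` bitv l) y.
  - by apply: openI; exact: open_bitv.
  - by [].
  - by move=> z [/(subb _ _ (ltW jk) (ltW kj))].
  have {}k'P (z : R) : bitv k' z -> (bitv k `&` bitv l) z.
    by move=> /andP[? ?]; apply: k'P; rewrite !ltW.
  exists k'; split=> // i; rewrite ltnS leq_eqVlt => /predU1P[->|/kP[l' [kl' Nl']]].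
    by exists l; split=> // z /k'P[].
  by exists l'; split=> // z /k'P[/kl'].
have [b [bS bX]] := selective_game sX bB cB.
have loS n : lo (b n) <= lo (b n.+1) :> R.
  by have [->//|[x _ [[/ltW ? _] _]]] := bS n.
have hiS n : hi (b n.+1) <= hi (b n) :> R.
  by have [->//|[x _ [[_ /ltW ?] _]]] := bS n.
have [y yb] := @nested_point R (lo \o b) (hi \o b) (fun n => lo_lt_hi _) loS hiS.
have [x Xx] : (\bigcup_(x in X) xsection H x) y by rewrite cov.
rewrite /xsection /= inE; apply: HN => i /=.
have [n ni [_ /(_ _ ni)[l [bl Nl]]]] := bX x Xx i.
exists l; split=> //; apply: bl.
(* The limit [y] is known only to lie in the closed intervals; a later strict shrinking puts it in
   the open one. *)
have [m nm [[lm hm] _]] := bX x Xx n.+1.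
have : bitv (b m) y by have /andP[/= ? ?] := yb m.+1; apply/andP; split; lra.
apply: subb.
  have := nm; apply: (@homo_leq _ (fun k => lo (b k)) (fun u v : R => u <= v)).
  - by [].
  - by move=> u v w; exact: le_trans.
  - exact: loS.
have := nm; apply: (@homo_leq _ (fun k => hi (b k)) (fun u v : R => v <= u)).
- by [].
- by move=> u v w uv vw; exact: le_trans vw uv.
- exact: hiS.
Qed.

(* For each [n], the intervals [piece n k] are pairwise disjoint subintervals of
   the [n]-th basic interval: a point of the line guesses at most one [k]. *)
Definition piece (R : realType) (n k : nat) : set R :=
  [set y | lo n + (hi n - lo n) / k.+2%:R < y < lo n + (hi n - lo n) / k.+1%:R].

Lemma piece_uniq (R : realType) (n j k : nat) (y : R) :
  piece n j y -> piece n k y -> j = k.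
Proof.
wlog jk : j k / (j < k)%N.
  move=> W jy ky; have [jk|kj|//] := ltngtP j k; first exact: W.
  by apply/esym/W.
move=> /andP[jy _] /andP[_ ky].
have d0 : 0 < hi n - lo n :> R by rewrite subr_gt0 lo_lt_hi.
have : (hi n - lo n) / k.+1%:R <= (hi n - lo n) / j.+2%:R :> R.
  by rewrite ler_pM2l// lef_pV2 ?posrE// ler_nat.
rewrite -(lerD2l (lo n)) => le.
by have := lt_trans jy (lt_le_trans ky le); rewrite ltxx.
Qed.

Lemma piece_nonempty (R : realType) (n k : nat) : exists y : R, piece n k y.
Proof.
exists (lo n + ((hi n - lo n) / k.+2%:R + (hi n - lo n) / k.+1%:R) / 2).
have d0 : 0 < hi n - lo n :> R by rewrite subr_gt0 lo_lt_hi.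
have : (hi n - lo n) / k.+2%:R < (hi n - lo n) / k.+1%:R :> R.
  by rewrite ltr_pM2l// ltf_pV2 ?posrE// ltr_nat.
rewrite /piece /=; set u := _ / k.+2%:R; set v := _ / k.+1%:R.
by move=> ?; apply/andP; split; lra.
Qed.

Lemma piece_bitv (R : realType) (n k : nat) : piece n k `<=` (bitv n : set R).
Proof.
rewrite /piece => y /= /andP[].
have d0 : 0 < hi n - lo n :> R by rewrite subr_gt0 lo_lt_hi.
have : 0 < (hi n - lo n) / k.+2%:R :> R by rewrite divr_gt0.
have : (hi n - lo n) / k.+1%:R <= (hi n - lo n) :> R.
  by rewrite ler_pdivrMr// ler_peMr ?ler1n// ltW.
set u := _ / k.+2%:R; set v := _ / k.+1%:R.
by move=> ? ? ? ?; apply/andP; split; lra.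
Qed.

Lemma RM_selective (R : realType) (X : set R) : RM_set X -> selective X.
Proof.
move=> RX U bU cU.
(* The first clause empties the section at any [x] missed by some cover: [M_set] concerns all reals,
   while [U] covers only [X]. *)
pose H : set (R * R) := [set p | (forall n, exists k, U n k p.1) /\
  forall q : nat * nat, ~ (piece q.1 q.2 p.2 /\ U q.1 q.2 p.1)].
have b1 n k : borel [set p : R * R | U n k p.1].
  by apply: (borel_preimage (f := fst)) => // p; exact: cvg_fst.
have b2 n k : borel [set p : R * R | piece n k p.2].
  apply: (borel_preimage (f := snd)) => [p|]; first exact: cvg_snd.
  by apply: borel_open; exact: open_oo.
have mH : M_set H.
  split.
    apply: borelI; first by apply: borel_all => n; apply: borel_ex => k; exact: b1.
    by apply: borel_all => q; apply: borelC; apply: borelI; [exact: b2|exact: b1].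
  move=> x; exists (fun=> xsection H x); last by move=> y; exists 0%N.
  move=> _; rewrite /nowhere_dense -subset0 => y y0.
  have [k [_ kH]] := bitvP (@open_interior _ _) y0.
  have kcl z : bitv k z -> closure (xsection H x) z.
    by move=> /andP[? ?]; apply: interior_subset; apply: kH; rewrite !ltW.
  have [z0 kz0] := @bitv_nonempty R k.
  have [z1 [+ _]] := kcl z0 kz0 _ (open_nbhs_nbhs (conj openT I)).
  rewrite /xsection /= inE => -[/= /(_ k)[j Ukj] _].
  (* As [x] lies in [U k j], the piece [piece k j] of the interval misses the section, against its
     density there. *)
  have [z pz] := @piece_nonempty R k j.
  have oz : open_nbhs z (piece k j) by split=> //; exact: open_oo.
  have [z2 [+ pz2]] := kcl z (piece_bitv pz) _ (open_nbhs_nbhs oz).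
  by rewrite /xsection /= inE => -[_ /(_ (k, j))]; apply.
have [y yH] : exists y, ~ (\bigcup_(x in X) xsection H x) y.
  apply: contrapT => nE; apply: (RX H mH); apply/seteqP; split=> // y _.
  by apply: contrapT => yH; apply: nE; exists y.
(* The guess read off from [y]; the default 0 stands where [y] lies in no piece. *)
exists (fun n => xget 0%N [set k | piece n k y]) => x Xx.
apply: contrapT => nU; apply: yH; exists x => //; rewrite /xsection /= inE.
split=> [n|[n k] /= [pk Uk]]; first exact: cU.
apply: nU; exists n; case: xgetP => [j _ /piece_uniq/(_ pk) ->//|/(_ k)].
by case.
Qed.

Theorem theorem1 (R : realType) (X : set R) :
  (A1_set X <->
     (forall Psi : R -> baire_space,
        borel_fun_on X Psi -> rothberger (Psi @` X))) /\
  ((forall Psi : R -> baire_space,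
      borel_fun_on X Psi -> rothberger (Psi @` X)) <->
     RM_set X).
Proof.
split; split.
- by move=> /A1_selective sX Psi; exact: selective_rothberger.
- by move=> /rothberger_selective; exact: selective_A1.
- by move=> /rothberger_selective; exact: selective_RM.
- by move=> /RM_selective sX Psi; exact: selective_rothberger.
Qed.
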